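(* Fix an integer $k\geq 1$. Let $\mathbb{F}=\mathbb{C}(x_0,\ldots,x_{2k},a)$ be the field of rational functions in independent indeterminates, and define $x_n\in\mathbb{F}$ for all $n\in\mathbb{Z}$ by iterating $x_{n+2k+1}x_n=x_{n+2k}x_{n+1}+a(x_{n+k}+x_{n+k+1})$ forwards and backwards from $x_0,\ldots,x_{2k}$. Then: (i) there exist $K^{(1)},K^{(2)}\in\mathbb{F}$ with $\varphi^*K^{(1)}=K^{(1)}$, $\varphi^*K^{(2)}=K^{(2)}$ (conserved quantities) and $K^{(2)}=\sigma^*K^{(1)}$, such that for all $n\in\mathbb{Z}$ $$x_{n+6k}-K^{(1)}x_{n+4k}+K^{(2)}x_{n+2k}-x_n=0;$$ (ii) there exist $\alpha_n,\beta_n,\gamma_n\in\mathbb{F}$ ($n\in\mathbb{Z}$) with $\alpha_n=(\varphi^* )^n\alpha_0$, $\beta_n=(\varphi^* )^n\beta_0$, $\gamma_n=(\varphi^* )^n\gamma_0$, $\alpha_{n+k}=\alpha_n$, $\beta_{n+2k}=\beta_n$, $\gamma_{n+2k}=\gamma_n$ (so $\alpha_0$ is a $k$-invariant and $\beta_0,\gamma_0$ are $2k$-invariants), such that for all $n\in\mathbb{Z}$ $$x_{n+3}-\gamma_n x_{n+2}+\beta_n x_{n+1}-\alpha_n x_n=0.$$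
   Context: All $x_n$ produced by the recurrence are nonzero elements of $\mathbb{F}$, so the iteration is well defined. $\varphi^*$ is the field automorphism of $\mathbb{F}$ given by pullback under the map $\varphi:(x_0,\ldots,x_{2k})\mapsto(x_1,\ldots,x_{2k},(x_1x_{2k}+a(x_k+x_{k+1}))/x_0)$, i.e. $\varphi^*G(x_0,\ldots,x_{2k},a)=G(x_1,\ldots,x_{2k+1},a)$; thus $(\varphi^* )^mx_n=x_{n+m}$. $\sigma^*$ is the field automorphism of $\mathbb{F}$ fixing $a$ with $\sigma^*x_j=x_{2k-j}$ for $0\le j\le 2k$ (pullback by the coordinate reversal $\sigma$); it satisfies $\sigma^*x_n=x_{2k-n}$ for all $n\in\mathbb{Z}$. A $p$-invariant is an element $G$ with $(\varphi^* )^pG=G$. *)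

(* Defs.v *)
From HB Require Import structures.
From mathcomp Require Import all_boot all_order all_algebra.
From mathcomp Require Import generic_quotient fraction.
From mathcomp Require Import reals.
From mathcomp Require Import complex mpoly.
From mathcomp Require Import zify.

Set Implicit Arguments.
Unset Strict Implicit.
Unset Printing Implicit Defensive.

Import GRing.Theory Num.Theory.
Local Open Scope ring_scope.
Local Open Scope complex_scope.

(* C(x_0, ..., x_(2k), a): the variables 'X_0, ..., 'X_(2k) of the polynomial
   ring are x_0, ..., x_(2k), and 'X_(2k+1) is a. *)
Definition ratField (R : realType) (k : nat) : fieldType :=
  {fraction {mpoly R[i][(2 * k).+2]}}.

Definition indet (R : realType) (k i : nat) : ratField R k :=
  tofrac ('X_(inord i) : {mpoly R[i][(2 * k).+2]}).

Definition par (R : realType) (k : nat) : ratField R k := indet R k (2 * k).+1.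

Definition coords (R : realType) (k : nat) : seq (ratField R k) :=
  mkseq (indet R k) (2 * k).+1.

(* A point (y_0, ..., y_(2k)) is a sequence of length 2k + 1. *)
Definition phi (R : realType) (k : nat) (y : seq (ratField R k)) :
    seq (ratField R k) :=
  rcons (behead y)
    ((y`_1 * y`_(2 * k) + par R k * (y`_k + y`_k.+1)) / y`_0).

(* The inverse of phi: (y_0, ..., y_(2k)) |-> (z, y_0, ..., y_(2k-1)), where
   y_(2k) z = y_(2k-1) y_0 + a (y_(k-1) + y_k). *)
Definition phi_inv (R : realType) (k : nat) (y : seq (ratField R k)) :
    seq (ratField R k) :=
  (y`_(2 * k).-1 * y`_0 + par R k * (y`_k.-1 + y`_k)) / y`_(2 * k)
    :: take (2 * k) y.

Definition sigma (R : realType) (k : nat) (y : seq (ratField R k)) :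
    seq (ratField R k) :=
  rev y.

Definition xseq (R : realType) (k : nat) (n : int) : ratField R k :=
  match n with
  | Posz m => (iter m (@phi R k) (coords R k))`_0
  | Negz m => (iter m.+1 (@phi_inv R k) (coords R k))`_0
  end.

Definition poly_at (R : realType) (k : nat) (y : seq (ratField R k))
    (p : {mpoly R[i][(2 * k).+2]}) : ratField R k :=
  mmap (@FracField.tofrac _ \o @mpolyC (2 * k).+2 R[i])
       (fun i => (rcons y (par R k))`_i) p.

(* G(y_0, ..., y_(2k), a). It does not depend on the representing quotient as
   long as y_0, ..., y_(2k), a are algebraically independent over C, which is
   the case for the three substitutions used below: see phi_star_rmorphism,
   phi_inv_star_rmorphism and sigma_star_rmorphism. *)
Definition eval_at (R : realType) (k : nat) (y : seq (ratField R k))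
    (G : ratField R k) : ratField R k :=
  poly_at y \n_(repr G) / poly_at y \d_(repr G).

Definition phi_star (R : realType) (k : nat) : ratField R k -> ratField R k :=
  eval_at (phi (coords R k)).

Definition phi_inv_star (R : realType) (k : nat) :
    ratField R k -> ratField R k :=
  eval_at (phi_inv (coords R k)).

Definition sigma_star (R : realType) (k : nat) : ratField R k -> ratField R k :=
  eval_at (sigma (coords R k)).

Definition phi_star_pow (R : realType) (k : nat) (n : int) :
    ratField R k -> ratField R k :=
  match n with
  | Posz m => iter m (@phi_star R k)
  | Negz m => iter m.+1 (@phi_inv_star R k)
  end.

(* phi_star and sigma_star are field automorphisms, phi_inv_star is the inverse
   of phi_star, and xseq is a nowhere zero solution of the recurrence with the
   prescribed initial values, shifted by phi_star. *)
Section Substitutions.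
Variables (R : realType) (k : nat).
Local Notation F := (ratField R k).
Local Notation P := {mpoly R[i][(2 * k).+2]}.
Local Notation toF := (@FracField.tofrac P : P -> F).
Implicit Types (y z : seq F) (p q : P).

Lemma toFE (G : F) : G = toF \n_(repr G) / toF \d_(repr G).
Proof.
have dn0 : toF \d_(repr G) != 0 by rewrite tofrac_eq0 denom_ratioP.
apply: (canRL (mulfK dn0)); rewrite -{1}[G]reprK.
rewrite [LHS]/GRing.mul /=; unlock FracField.tofrac; rewrite /= -FracField.pi_mul.
apply/eqmodP; rewrite /= FracField.equivfE /= /FracField.mulf.
rewrite !numden_Ratio ?mulr1 ?oner_neq0 ?mul1r ?denom_ratioP //.
by rewrite mulrC.
Qed.

Lemma poly_at_zmod y : zmod_morphism (poly_at y).
Proof. by move=> p q; rewrite /poly_at rmorphB. Qed.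

Lemma poly_at_monoid y : monoid_morphism (poly_at y).
Proof.
by split=> [|p q]; rewrite /poly_at ?rmorph1 // rmorphM.
Qed.

HB.instance Definition _ y :=
  GRing.isZmodMorphism.Build P F (poly_at y) (poly_at_zmod y).
HB.instance Definition _ y :=
  GRing.isMonoidMorphism.Build P F (poly_at y) (poly_at_monoid y).

Lemma poly_atD y : {morph poly_at y : p q / p + q}.
Proof. exact: rmorphD. Qed.

Lemma poly_at1 y : poly_at y 1 = 1.
Proof. exact: rmorph1. Qed.

Lemma poly_atM y : {morph poly_at y : p q / p * q}.
Proof. exact: rmorphM. Qed.

Lemma poly_atXn y n : {morph poly_at y : p / p ^+ n}.
Proof. exact: rmorphXn. Qed.

Lemma poly_atC y c : poly_at y c%:MP = toF c%:MP.
Proof. by rewrite /poly_at mmapC. Qed.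

Lemma poly_atX y (i : 'I_(2 * k).+2) :
  poly_at y 'X_i = (rcons y (par R k))`_i.
Proof. by rewrite /poly_at mmapX mmap1U. Qed.

Lemma ratField_numden (G : F) : exists p q, [/\ q != 0, G = toF p / toF q,
  p = \n_(repr G) & q = \d_(repr G)].
Proof.
by exists \n_(repr G), \d_(repr G); rewrite denom_ratioP; split => //; exact: toFE.
Qed.

Lemma eval_at_frac y p q : injective (poly_at y) -> q != 0 ->
  eval_at y (toF p / toF q) = poly_at y p / poly_at y q.
Proof.
move=> inj_y q0; rewrite /eval_at.
have [n [d [d0 E <- <-]]] := ratField_numden (toF p / toF q).
have nz r : r != 0 -> poly_at y r != 0 by move=> ?; rewrite raddf_eq0.
have tz r : r != 0 -> toF r != 0 by rewrite tofrac_eq0.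
apply/eqP; rewrite eqr_div ?nz // -!rmorphM /= (inj_eq inj_y).
by rewrite -(tofrac_eq _ (_ * _)) !tofracM -eqr_div ?tz // E.
Qed.

Section Injective.
Variables (y z : seq F) (D : P).
Hypothesis D_neq0 : poly_at z D != 0.
Hypothesis yz : forall i : 'I_(2 * k).+2, exists2 q,
  toF q = toF D * (rcons y (par R k))`_i & poly_at z q = poly_at z D * toF 'X_i.

Let good p := exists m q,
  toF q = toF D ^+ m * poly_at y p /\ poly_at z q = poly_at z D ^+ m * toF p.

Let goodC c : good c%:MP.
Proof. by exists 0%N, c%:MP; rewrite !expr0 !mul1r !poly_atC. Qed.

Let goodM p q : good p -> good q -> good (p * q).
Proof.
move=> [m [p' [e1 e2]]] [n [q' [e3 e4]]]; exists (m + n)%N, (p' * q').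
by rewrite tofracM !rmorphM /= e1 e2 e3 e4 !exprD mulrACA; split=> //; rewrite mulrACA.
Qed.

Let goodD p q : good p -> good q -> good (p + q).
Proof.
move=> [m [p' [e1 e2]]] [n [q' [e3 e4]]].
exists (m + n)%N, (D ^+ n * p' + D ^+ m * q').
rewrite tofracD !tofracM !tofracXn !rmorphD !rmorphM !rmorphXn /= e1 e2 e3 e4.
by rewrite !mulrDr !mulrA -!exprD addnC.
Qed.

Let goodX i : good 'X_i.
Proof.
by have [q e1 e2] := yz i; exists 1%N, q; rewrite !expr1 poly_atX.
Qed.

Let good_all p : good p.
Proof.
elim/mpolyind: p => [|c m p _ _ IH]; first by rewrite -mpolyC0; exact: goodC.
apply: goodD IH; rewrite -mul_mpolyC; apply: goodM; first exact: goodC.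
rewrite mpolyXE_id; apply: (big_ind good) => [||i _].
- by rewrite -mpolyC1; exact: goodC.
- exact: goodM.
- elim: (m i) => [|n IHn]; first by rewrite expr0 -mpolyC1; exact: goodC.
  by rewrite exprS; exact: goodM.
Qed.

Lemma poly_at_inj : injective (poly_at y).
Proof.
apply: raddf_inj => p py0; have [m [q [e1 e2]]] := good_all p.
have q0 : q = 0 by apply/eqP; rewrite -tofrac_eq0 e1 py0 mulr0.
move: e2; rewrite q0 raddf0 => /esym/eqP.
by rewrite mulf_eq0 expf_eq0 (negbTE D_neq0) andbF tofrac_eq0 => /eqP.
Qed.

End Injective.

Section Morphism.
Variable y : seq F.
Hypothesis inj_y : injective (poly_at y).

Lemma eval_at_toF p : eval_at y (toF p) = poly_at y p.
Proof.
have := eval_at_frac p inj_y (oner_neq0 _).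
by rewrite tofrac1 rmorph1 !divr1.
Qed.

Lemma eval_atB : zmod_morphism (eval_at y).
Proof.
move=> G H.
have [n [d [d0 -> _ _]]] := ratField_numden G.
have [n' [d' [d'0 -> _ _]]] := ratField_numden H.
have nz r : r != 0 -> poly_at y r != 0 by move=> ?; rewrite raddf_eq0.
have tz r : r != 0 -> toF r != 0 by rewrite tofrac_eq0.
rewrite -mulNr addf_div ?tz // -tofracN -!tofracM -tofracD.
rewrite !eval_at_frac ?mulf_neq0 // -[in RHS]mulNr addf_div ?nz //.
by rewrite !(rmorphD, rmorphM, rmorphN).
Qed.

Lemma eval_atM : monoid_morphism (eval_at y).
Proof.
split=> [|G H]; first by rewrite -tofrac1 eval_at_toF rmorph1.
have [n [d [d0 -> _ _]]] := ratField_numden G.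
have [n' [d' [d'0 -> _ _]]] := ratField_numden H.
by rewrite mulf_div -!tofracM !eval_at_frac ?mulf_neq0 // !rmorphM /= mulf_div.
Qed.

End Morphism.

Lemma eval_at_can y z :
    injective (poly_at y) -> injective (poly_at z) ->
    (forall i : 'I_(2 * k).+2, eval_at y (rcons z (par R k))`_i = toF 'X_i) ->
  cancel (eval_at z) (eval_at y).
Proof.
move=> iy iz H G.
pose ey := GRing.isZmodMorphism.Build F F (eval_at y) (eval_atB iy).
pose em := GRing.isMonoidMorphism.Build F F (eval_at y) (eval_atM iy).
pose E : {rmorphism F -> F} := HB.pack (eval_at y) ey em.
have Ep p : E (poly_at z p) = toF p.
  elim/mpolyind: p => [|c m p _ _ IH]; first by rewrite !raddf0.
  rewrite poly_atD [E _]rmorphD IH tofracD; congr (_ + _).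
  rewrite -mul_mpolyC poly_atM [E _]rmorphM tofracM poly_atC.
  have -> : E (toF c%:MP) = toF c%:MP by rewrite /= eval_at_toF // poly_atC.
  congr (_ * _); rewrite mpolyXE_id.
  apply: (big_ind (fun p => E (poly_at z p) = toF p)) => [|p1 p2 e1 e2|i _].
  - by rewrite poly_at1 [E _]rmorph1 tofrac1.
  - by rewrite poly_atM [E _]rmorphM e1 e2 tofracM.
  - by rewrite poly_atXn [E _]rmorphXn tofracXn poly_atX /= H.
have [n [d [d0 -> _ _]]] := ratField_numden G.
by rewrite eval_at_frac // -[eval_at y _]/(E _) fmorph_div !Ep.
Qed.

Hypothesis k_gt0 : (0 < k)%N.
Local Notation X j := ('X_(inord j) : P).
Local Notation x := (indet R k).
Local Notation a := (par R k).
Local Notation pt y := (rcons y a).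

Let phi_num : P :=
  X 1 * X (2 * k) + X (2 * k).+1 * (X k + X k.+1).
Let phi_inv_num : P :=
  X (2 * k).-1 * X 0 + X (2 * k).+1 * (X k.-1 + X k).

Lemma nth_coords j : (j <= 2 * k)%N -> (coords R k)`_j = x j.
Proof. by move=> h; rewrite nth_mkseq. Qed.

Lemma phi_coords (j : nat) : (j < (2 * k).+2)%N ->
  (pt (phi (coords R k)))`_j =
    if (j < 2 * k)%N then x j.+1
    else if j == (2 * k)%N then toF phi_num / x 0 else a.
Proof.
move=> h; rewrite /phi !nth_coords ?nth_rcons; try lia.
rewrite size_rcons size_behead size_mkseq [_.-1]/=.
have [h1|h1] := ltnP j (2 * k); first by rewrite ltnS ltnW // nth_behead nth_coords.
rewrite ltnS; have [->|ne] := eqVneq j (2 * k)%N.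
  by rewrite leqnn /phi_num !(tofracD, tofracM).
by rewrite ifF ?ifT //; lia.
Qed.

Lemma phi_inv_coords (j : nat) : (j < (2 * k).+2)%N ->
  (pt (phi_inv (coords R k)))`_j =
    if j == 0%N then toF phi_inv_num / x (2 * k)
    else if (j <= 2 * k)%N then x j.-1 else a.
Proof.
move=> h; rewrite /phi_inv !nth_coords ?nth_rcons; try lia.
rewrite /= size_takel ?size_mkseq; last lia.
case: j h => [|j] h /=; first by rewrite /phi_inv_num !(tofracD, tofracM).
rewrite !ltnS; have [h1|h1] := ltnP j (2 * k).
  by rewrite nth_take // nth_coords // ltnW.
by rewrite ifT //; lia.
Qed.

Lemma sigma_coords (j : nat) : (j < (2 * k).+2)%N ->
  (pt (sigma (coords R k)))`_j = if (j <= 2 * k)%N then x (2 * k - j) else a.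
Proof.
move=> h; rewrite nth_rcons size_rev size_mkseq ltnS.
case: leqP => h1; last by rewrite ifT //; lia.
by rewrite nth_rev size_mkseq // nth_coords; [congr (x _); lia | lia].
Qed.

Lemma poly_at_indet y (j : nat) : (j < (2 * k).+2)%N -> poly_at y (X j) = (pt y)`_j.
Proof. by move=> h; rewrite poly_atX inordK. Qed.

Lemma indet_neq0 j : x j != 0.
Proof.
rewrite tofrac_eq0; apply/eqP => /(congr1 (meval (fun=> 1 : R[i]))).
by rewrite meval0 mevalXU => /eqP; rewrite oner_eq0.
Qed.

Lemma phi_num_neq0 : toF phi_num != 0.
Proof.
rewrite tofrac_eq0; apply/eqP => /(congr1 (meval (fun=> 1 : R[i]))).
rewrite meval0 /phi_num !(mevalD, mevalM, mevalXU) !mul1r => /eqP.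
by rewrite -[_ + _]/(3%:R) pnatr_eq0.
Qed.

Lemma phi_inv_num_neq0 : toF phi_inv_num != 0.
Proof.
rewrite tofrac_eq0; apply/eqP => /(congr1 (meval (fun=> 1 : R[i]))).
rewrite meval0 /phi_inv_num !(mevalD, mevalM, mevalXU) !mul1r => /eqP.
by rewrite -[_ + _]/(3%:R) pnatr_eq0.
Qed.

Lemma phi_inv_indet j : (0 < j <= 2 * k)%N ->
  poly_at (phi_inv (coords R k)) (X j) = x j.-1.
Proof.
by move=> h; rewrite poly_at_indet ?phi_inv_coords; [rewrite ifF ?ifT //|..]; lia.
Qed.

Lemma phi_indet j : (j < 2 * k)%N ->
  poly_at (phi (coords R k)) (X j) = x j.+1.
Proof.
by move=> h; rewrite poly_at_indet ?phi_coords; [rewrite ifT //|..]; lia.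
Qed.

Lemma phi_inv_par : poly_at (phi_inv (coords R k)) (X (2 * k).+1) = a.
Proof.
by rewrite poly_at_indet ?phi_inv_coords //= ltnn.
Qed.

Lemma phi_par : poly_at (phi (coords R k)) (X (2 * k).+1) = a.
Proof.
by rewrite poly_at_indet ?phi_coords // !ifF //; lia.
Qed.

Lemma phi_last :
  poly_at (phi (coords R k)) (X (2 * k)) = toF phi_num / x 0.
Proof. by rewrite poly_at_indet ?phi_coords // ltnn eqxx. Qed.

Lemma phi_inv_first :
  poly_at (phi_inv (coords R k)) (X 0) = toF phi_inv_num / x (2 * k).
Proof. by rewrite poly_at_indet ?phi_inv_coords // ltnn eqxx. Qed.

Lemma poly_at_phi_num : poly_at (phi_inv (coords R k)) phi_num = toF phi_inv_num.
Proof.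
rewrite /phi_num !(poly_atD, poly_atM) phi_inv_par !phi_inv_indet; try lia.
by rewrite /phi_inv_num !(tofracD, tofracM) /= [x 0 * _]mulrC.
Qed.

Lemma poly_at_phi_inv_num : poly_at (phi (coords R k)) phi_inv_num = toF phi_num.
Proof.
rewrite /phi_inv_num !(poly_atD, poly_atM) phi_par !phi_indet; try lia.
rewrite !prednK; try lia.
by rewrite /phi_num !(tofracD, tofracM) /= [x 1 * _]mulrC.
Qed.

Lemma ordX (i : 'I_(2 * k).+2) : 'X_i = X i.
Proof. by rewrite inord_val. Qed.

Lemma phi_inj : injective (poly_at (phi (coords R k))).
Proof.
apply: (@poly_at_inj _ (phi_inv (coords R k)) (X 0)) => [|i].
  by rewrite phi_inv_first mulf_neq0 ?invr_eq0 ?indet_neq0 ?phi_inv_num_neq0.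
rewrite (ordX i) phi_coords //; case: ltnP => h1; last have [E|h2] := eqVneq (i : nat) (2 * k)%N.
- exists (X 0 * X i.+1); first exact: tofracM.
  rewrite poly_atM [poly_at _ (X i.+1)]phi_inv_indet; [by [] | lia].
- rewrite E; exists phi_num; first by rewrite mulrC divfK // indet_neq0.
  by rewrite poly_at_phi_num phi_inv_first divfK // indet_neq0.
- have -> : i = (2 * k).+1 :> nat by have := ltn_ord i; lia.
  exists (X 0 * X (2 * k).+1); first exact: tofracM.
  by rewrite poly_atM phi_inv_par.
Qed.

Lemma phi_inv_inj : injective (poly_at (phi_inv (coords R k))).
Proof.
apply: (@poly_at_inj _ (phi (coords R k)) (X (2 * k))) => [|i].
  by rewrite phi_last mulf_neq0 ?invr_eq0 ?indet_neq0 ?phi_num_neq0.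
rewrite (ordX i) phi_inv_coords //; have [E|h1] := eqVneq (i : nat) 0%N; last case: leqP => h2.
- rewrite E; exists phi_inv_num; first by rewrite mulrC divfK // indet_neq0.
  by rewrite poly_at_phi_inv_num phi_last divfK // indet_neq0.
- exists (X (2 * k) * X i.-1); first exact: tofracM.
  rewrite poly_atM [poly_at _ (X i.-1)]phi_indet ?prednK; [by []|lia..].
- have -> : i = (2 * k).+1 :> nat by have := ltn_ord i; lia.
  exists (X (2 * k) * X (2 * k).+1); first exact: tofracM.
  by rewrite poly_atM phi_par.
Qed.

Lemma sigma_sigma (i : 'I_(2 * k).+2) :
  exists2 q, toF q = (pt (sigma (coords R k)))`_i &
             poly_at (sigma (coords R k)) q = toF 'X_i.
Proof.
rewrite (ordX i) sigma_coords //; case: leqP => h1.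
  exists (X (2 * k - i)) => //; rewrite poly_at_indet; last lia.
  by rewrite sigma_coords ?leq_subr ?subKn //; lia.
have -> : i = (2 * k).+1 :> nat by have := ltn_ord i; lia.
by exists (X (2 * k).+1); rewrite // poly_at_indet // sigma_coords // ltnn.
Qed.

Lemma sigma_inj : injective (poly_at (sigma (coords R k))).
Proof.
apply: (@poly_at_inj _ (sigma (coords R k)) 1) => [|i].
  by rewrite poly_at1 oner_neq0.
have [q e1 e2] := sigma_sigma i; exists q; first by rewrite tofrac1 mul1r.
by rewrite poly_at1 mul1r.
Qed.

Lemma phi_star_rmorphism :
  zmod_morphism (@phi_star R k) * monoid_morphism (@phi_star R k).
Proof. exact: (eval_atB phi_inj, eval_atM phi_inj). Qed.

Lemma phi_inv_star_rmorphism :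
  zmod_morphism (@phi_inv_star R k) * monoid_morphism (@phi_inv_star R k).
Proof. exact: (eval_atB phi_inv_inj, eval_atM phi_inv_inj). Qed.

Lemma sigma_star_rmorphism :
  zmod_morphism (@sigma_star R k) * monoid_morphism (@sigma_star R k).
Proof. exact: (eval_atB sigma_inj, eval_atM sigma_inj). Qed.

Lemma sigma_starK : involutive (@sigma_star R k).
Proof.
apply: eval_at_can sigma_inj sigma_inj _ => i.
have [q e1 e2] := sigma_sigma i.
by rewrite -e1 -e2; exact: (eval_at_toF sigma_inj q).
Qed.

Lemma phi_starK : cancel (@phi_star R k) (@phi_inv_star R k).
Proof.
apply: eval_at_can phi_inv_inj phi_inj _ => i.
rewrite (ordX i) phi_coords //; case: ltnP => h1; last have [E|h2] := eqVneq (i : nat) (2 * k)%N.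
- rewrite (eval_at_toF phi_inv_inj) phi_inv_indet; [by [] | lia].
- rewrite E eval_at_frac; first last.
  + by rewrite -tofrac_eq0 indet_neq0.
  + exact: phi_inv_inj.
  rewrite poly_at_phi_num phi_inv_first invf_div mulrCA divff ?mulr1 //.
  exact: phi_inv_num_neq0.
- have -> : i = (2 * k).+1 :> nat by have := ltn_ord i; lia.
  by rewrite (eval_at_toF phi_inv_inj) phi_inv_par.
Qed.

Lemma phi_inv_starK : cancel (@phi_inv_star R k) (@phi_star R k).
Proof.
apply: eval_at_can phi_inj phi_inv_inj _ => i.
rewrite (ordX i) phi_inv_coords //; have [E|h1] := eqVneq (i : nat) 0%N; last case: leqP => h2.
- rewrite E eval_at_frac; first last.
  + by rewrite -tofrac_eq0 indet_neq0.
  + exact: phi_inj.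
  rewrite poly_at_phi_inv_num phi_last invf_div mulrCA divff ?mulr1 //.
  exact: phi_num_neq0.
- rewrite (eval_at_toF phi_inj) phi_indet ?prednK; [by [] | lia..].
- have -> : i = (2 * k).+1 :> nat by have := ltn_ord i; lia.
  by rewrite (eval_at_toF phi_inj) phi_par.
Qed.

Let Phi : {rmorphism F -> F} := HB.pack (@phi_star R k)
  (GRing.isZmodMorphism.Build F F _ phi_star_rmorphism.1)
  (GRing.isMonoidMorphism.Build F F _ phi_star_rmorphism.2).

Let Psi : {rmorphism F -> F} := HB.pack (@phi_inv_star R k)
  (GRing.isZmodMorphism.Build F F _ phi_inv_star_rmorphism.1)
  (GRing.isMonoidMorphism.Build F F _ phi_inv_star_rmorphism.2).

Lemma phi_star_par : phi_star a = a.
Proof. by rewrite /phi_star (eval_at_toF phi_inj) phi_par. Qed.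

Lemma phi_star_indet j : (j < 2 * k)%N -> phi_star (x j) = x j.+1.
Proof. by move=> h; rewrite /phi_star (eval_at_toF phi_inj) phi_indet. Qed.

Lemma phi_inv_star_par : phi_inv_star a = a.
Proof. by rewrite /phi_inv_star (eval_at_toF phi_inv_inj) phi_inv_par. Qed.

Lemma size_phi (y : seq F) : size y = (2 * k).+1 -> size (phi y) = (2 * k).+1.
Proof. by rewrite size_rcons size_behead => ->. Qed.

Lemma size_phi_inv (y : seq F) :
  size y = (2 * k).+1 -> size (phi_inv y) = (2 * k).+1.
Proof. by move=> h /=; rewrite size_takel // h. Qed.

Lemma nth_phi (y : seq F) j : size y = (2 * k).+1 -> (j < 2 * k)%N -> (phi y)`_j = y`_j.+1.
Proof. by move=> sy h; rewrite nth_rcons size_behead sy h nth_behead. Qed.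

Lemma map_phi (y : seq F) : size y = (2 * k).+1 ->
  [seq phi_star v | v <- phi y] = phi [seq phi_star v | v <- y].
Proof.
move=> sy; rewrite /phi map_rcons behead_map !(nth_map 0) ?sy; try lia.
rewrite -[@phi_star R k]/(Phi : F -> F) fmorph_div rmorphD !rmorphM rmorphD.
by rewrite [Phi a]phi_star_par.
Qed.

Lemma map_phi_inv (y : seq F) : size y = (2 * k).+1 ->
  [seq phi_inv_star v | v <- phi_inv y] = phi_inv [seq phi_inv_star v | v <- y].
Proof.
move=> sy; rewrite /phi_inv map_cons map_take !(nth_map 0) ?sy; try lia.
rewrite -[@phi_inv_star R k]/(Psi : F -> F) fmorph_div rmorphD !rmorphM rmorphD.
by rewrite [Psi a]phi_inv_star_par.
Qed.

Lemma phi_coords_map : phi (coords R k) = [seq phi_star v | v <- coords R k].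
Proof.
apply: (@eq_from_nth _ 0) => [|j].
  by rewrite size_map size_phi size_mkseq.
rewrite size_phi ?size_mkseq // => h; rewrite (nth_map 0) ?size_mkseq //.
rewrite nth_coords // /phi_star (eval_at_toF phi_inj) poly_at_indet ?nth_rcons; last lia.
by rewrite size_phi ?size_mkseq // h.
Qed.

Lemma phi_inv_coords_map :
  phi_inv (coords R k) = [seq phi_inv_star v | v <- coords R k].
Proof.
apply: (@eq_from_nth _ 0) => [|j].
  by rewrite size_map size_phi_inv size_mkseq.
rewrite size_phi_inv ?size_mkseq // => h; rewrite (nth_map 0) ?size_mkseq //.
rewrite nth_coords // /phi_inv_star (eval_at_toF phi_inv_inj) poly_at_indet ?nth_rcons; last lia.
by rewrite size_phi_inv ?size_mkseq // h.
Qed.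

Lemma iter_phi m : iter m (@phi R k) (coords R k) =
  [seq iter m (@phi_star R k) v | v <- coords R k].
Proof.
elim: m => [|m IH]; first by rewrite /= map_id.
rewrite iterS IH.
have -> : map (iter m.+1 (@phi_star R k)) (coords R k) =
    map (iter m (@phi_star R k)) (phi (coords R k)).
  by rewrite phi_coords_map -map_comp; apply: eq_map => v /=; rewrite -iterSr.
elim: m {IH} => [|m IH]; first by rewrite !map_id.
have mS (s : seq F) : map (iter m.+1 (@phi_star R k)) s =
   map (@phi_star R k) (map (iter m (@phi_star R k)) s) by rewrite -map_comp.
by rewrite !mS -IH map_phi // size_map size_mkseq.
Qed.

Lemma iter_phi_inv m : iter m (@phi_inv R k) (coords R k) =
  [seq iter m (@phi_inv_star R k) v | v <- coords R k].
Proof.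
elim: m => [|m IH]; first by rewrite /= map_id.
rewrite iterS IH.
have -> : map (iter m.+1 (@phi_inv_star R k)) (coords R k) =
    map (iter m (@phi_inv_star R k)) (phi_inv (coords R k)).
  by rewrite phi_inv_coords_map -map_comp; apply: eq_map => v /=; rewrite -iterSr.
elim: m {IH} => [|m IH]; first by rewrite !map_id.
have mS (s : seq F) : map (iter m.+1 (@phi_inv_star R k)) s =
   map (@phi_inv_star R k) (map (iter m (@phi_inv_star R k)) s) by rewrite -map_comp.
by rewrite !mS -IH map_phi_inv // size_map size_mkseq.
Qed.

Lemma xseqE n : xseq R k n = phi_star_pow n (x 0).
Proof.
have sz : (0 < size (coords R k))%N by rewrite size_mkseq.
by case: n => m; rewrite /xseq ?iter_phi ?iter_phi_inv (nth_map 0 _ _ sz) nth_coords.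
Qed.

Lemma phi_star_powS n (v : F) : phi_star_pow (n + 1) v = phi_star (phi_star_pow n v).
Proof.
case: n => [m|[|m]]; first by rewrite -PoszD addn1.
  by rewrite /= phi_inv_starK.
have -> : Negz m.+1 + 1 = Negz m by lia.
by rewrite [in RHS]/phi_star_pow iterS phi_inv_starK.
Qed.

Lemma phi_star_xseq n : phi_star (xseq R k n) = xseq R k (n + 1).
Proof. by rewrite !xseqE phi_star_powS. Qed.

Lemma xseq_indet j : (j <= 2 * k)%N -> xseq R k j%:Z = x j.
Proof.
rewrite xseqE; elim: j => [//|j IH] h.
by rewrite -addn1 PoszD phi_star_powS IH ?phi_star_indet ?addn1 //; lia.
Qed.

Lemma xseq_neq0 n : xseq R k n != 0.
Proof.
have Phi0 (v : F) : (phi_star v == 0) = (v == 0) := fmorph_eq0 Phi v.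
have Psi0 (v : F) : (phi_inv_star v == 0) = (v == 0) := fmorph_eq0 Psi v.
rewrite xseqE; case: n => m; rewrite /phi_star_pow.
  by elim: m => [|m IH]; [exact: indet_neq0 | rewrite iterS Phi0].
by elim: m.+1 => [|p IH]; [exact: indet_neq0 | rewrite iterS Psi0].
Qed.

Lemma xseq_rec (n : int) :
  xseq R k (n + (2 * k).+1%:Z) * xseq R k n =
    xseq R k (n + (2 * k)%:Z) * xseq R k (n + 1)
    + a * (xseq R k (n + k%:Z) + xseq R k (n + k.+1%:Z)).
Proof.
pose Q n := xseq R k (n + (2 * k).+1%:Z) * xseq R k n =
    xseq R k (n + (2 * k)%:Z) * xseq R k (n + 1)
    + a * (xseq R k (n + k%:Z) + xseq R k (n + k.+1%:Z)).
have QS m : Q m <-> Q (m + 1).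
  have E (z : int) : xseq R k (m + 1 + z) = Phi (xseq R k (m + z)).
    by rewrite /= phi_star_xseq addrAC.
  have E0 : xseq R k (m + 1) = Phi (xseq R k m) by rewrite /= phi_star_xseq.
  have Ea : a = Phi a by rewrite /= phi_star_par.
  rewrite /Q !E E0 [in a * (Phi _ + _)]Ea -!(rmorphD, rmorphM).
  by split=> [->|/(fmorph_inj Phi)].
have Q0 : Q 0.
  have E1 : xseq R k (2 * k).+1%:Z = toF phi_num / x 0.
    have -> : (2 * k).+1%:Z = (2 * k)%:Z + 1 by rewrite -PoszD addn1.
    by rewrite -phi_star_xseq xseq_indet // -phi_last -(eval_at_toF phi_inj).
  rewrite /Q !add0r E1 (xseq_indet (leq0n _)) (@xseq_indet 1); last lia.
  rewrite !xseq_indet; try lia.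
  rewrite divfK ?indet_neq0 //.
  by rewrite /phi_num !(tofracD, tofracM) [x (2 * k) * _]mulrC.
rewrite -/(Q n); case: n => m.
  by elim: m => [//|m /QS]; rewrite -PoszD addn1.
elim: m => [|m IH]; apply/QS; first by [].
by have -> : Negz m.+1 + 1 = Negz m by lia.
Qed.

End Substitutions.

(* Main.v *)
Require Import Defs.
From HB Require Import structures.
From mathcomp Require Import all_boot all_order all_algebra reals.
From mathcomp Require Import fraction complex mpoly zify ring.

Set Implicit Arguments.
Unset Strict Implicit.
Unset Printing Implicit Defensive.

Import Order.TTheory GRing.Theory Num.Theory.
Local Open Scope ring_scope.

(* Put y_n = x_n + x_(n+1). The recurrence says that the 2x2 determinants
   x_n x_(n+2k+1) - x_(n+1) x_(n+2k) equal a y_(n+k). Dodgson condensation then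
   gives, for the 3x3 determinant delta_n of (x_(n+i+2kj)), i, j = 0, 1, 2,
     delta_n x_(n+2k+1) x_(n+k+1)
       = a^3 (y_(n+k) y_(n+2k+1) + y_(n+k+1) y_(n+2k)),
   from which delta_(n+k) = delta_n. By Cramer's rule any four consecutive rows
   (resp. columns) of the array (x_(n+i+2kj)) satisfy a linear relation over
   three columns (resp. rows), whose last coefficient is a ratio of deltas.
   Moving one column (resp. row) further keeps that ratio, and the two relations
   overlap in a nonzero 2x2 determinant, so all their coefficients agree. The
   determinants do not vanish because x_n, for n >= 0, is a quotient of
   polynomials that are positive at (1, ..., 1). *)

Lemma int_shift_ind (P : int -> Prop) :
  P 0 -> (forall n, P n <-> P (n + 1)) -> forall n, P n.
Proof.
move=> P0 PS; case=> m.
  by elim: m => [//|m /PS]; rewrite -PoszD addn1.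
elim: m => [|m IH]; apply/PS; first by [].
by have -> : Negz m.+1 + 1 = Negz m by lia.
Qed.

(** * Identities for determinants of order two and three *)

Section Determinants.
Variable F : fieldType.
Implicit Types a b c d p q r u v w : F.

Definition triple u v w p q r a b c : F :=
  u * (q * c - r * b) - v * (p * c - r * a) + w * (p * b - q * a).

Lemma triple_tr u v w p q r a b c :
  triple u v w p q r a b c = triple u p a v q b w r c.
Proof. by rewrite /triple; ring. Qed.

(** Dodgson condensation around the central entry [q]: the four factors on the right are the
    contiguous 2x2 minors. *)
Lemma triple_condensation u v w p q r a b c :
  triple u v w p q r a b c * q =
  (u * q - v * p) * (q * c - r * b) - (p * b - q * a) * (v * r - w * q).
Proof. by rewrite /triple; ring. Qed.

(** Four vectors of a three-dimensional space are dependent, the coefficient of each being, up to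
    sign, the minor that omits it; division by [d012] makes the last vector's coefficient 1. *)
Lemma cramer3 u0 u1 u2 u3 v0 v1 v2 v3 w0 w1 w2 w3 :
  let d012 := triple u0 v0 w0 u1 v1 w1 u2 v2 w2 in
  let d013 := triple u0 v0 w0 u1 v1 w1 u3 v3 w3 in
  let d023 := triple u0 v0 w0 u2 v2 w2 u3 v3 w3 in
  let d123 := triple u1 v1 w1 u2 v2 w2 u3 v3 w3 in
  d012 != 0 ->
  [/\ u3 - d013 / d012 * u2 + d023 / d012 * u1 - d123 / d012 * u0 = 0,
      v3 - d013 / d012 * v2 + d023 / d012 * v1 - d123 / d012 * v0 = 0 &
      w3 - d013 / d012 * w2 + d023 / d012 * w1 - d123 / d012 * w0 = 0].
Proof.
move=> d012 d013 d023 d123 nz.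
have clear_den z3 z2 z1 z0 :
    d012 * z3 - d013 * z2 + d023 * z1 - d123 * z0 = 0 ->
    z3 - d013 / d012 * z2 + d023 / d012 * z1 - d123 / d012 * z0 = 0.
  by move=> h; apply: (mulfI nz); rewrite mulr0 -[RHS]h; field.
by split; apply: clear_den; rewrite /d012 /d013 /d023 /d123 /triple; ring.
Qed.

Lemma kernel2_eq0 p q u v c d :
  u * d - v * c != 0 -> p * u = q * v -> p * c = q * d -> p = 0 /\ q = 0.
Proof.
move=> nz e1 e2; split; apply: (mulIf nz); rewrite mul0r.
  have -> : p * (u * d - v * c) = (p * u) * d - v * (p * c) by ring.
  by rewrite e1 e2; ring.
have -> : q * (u * d - v * c) = u * (q * d) - (q * v) * c by ring.
by rewrite -e1 -e2; ring.
Qed.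

End Determinants.

(** * Linear relations in the array [x (n + i t + j s)] *)

Section ShiftedMinors.
Variables (F : fieldType) (x : int -> F).

Definition minor (s n0 n1 n2 : int) : F :=
  triple (x n0) (x (n0 + s)) (x (n0 + s + s))
         (x n1) (x (n1 + s)) (x (n1 + s + s))
         (x n2) (x (n2 + s)) (x (n2 + s + s)).

Definition gram (s t n : int) : F := minor s n (n + t) (n + t + t).

(** Exchanging the two steps transposes the array. Hence one argument serves twice: with [s = k2],
    [t = 1] for the relation of order three, and with [s = 1], [t = k2] for the conserved
    quantities. *)
Lemma gramC s t n : gram s t n = gram t s n.
Proof. by rewrite /gram /minor triple_tr; congr triple; congr x; ring. Qed.

(** Cramer coefficients for the rows [n], [n + t], [n + 2t], [n + 3t]. The numerator of [coef3]
    omits row [n], so it is again a [gram]. *)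
Definition coef1 s t n := minor s n (n + t) (n + t + t + t) / gram s t n.
Definition coef2 s t n := minor s n (n + t + t) (n + t + t + t) / gram s t n.
Definition coef3 s t n := gram s t (n + t) / gram s t n.

Section Periodicity.
Variables s t : int.
Hypothesis gram_neq0 : forall n, gram s t n != 0.
Hypothesis wronskian_neq0 :
  forall n, x n * x (n + s + t) - x (n + s) * x (n + t) != 0.
Hypothesis coef3_periodic : forall n, coef3 s t (n + s) = coef3 s t n.

(** The coefficients are based at [n] but tested at position [m], so that relations with different
    base points can be compared at the same position. *)
Let relation (n m : int) := x (m + t + t + t) - coef1 s t n * x (m + t + t)
  + coef2 s t n * x (m + t) - coef3 s t n * x m = 0.

Lemma coef_relations n :
  [/\ relation n n, relation n (n + s) & relation n (n + s + s)].
Proof.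
have := cramer3 (x (n + t + t + t)) (x (n + t + t + t + s))
  (x (n + t + t + t + s + s)) (gram_neq0 n).
rewrite -/(minor _ _ _ _) -/(minor _ _ _ _) -/(minor _ _ _ _) -/(gram s t n).
rewrite -/(gram s t (n + t)) -/(coef1 s t n) -/(coef2 s t n) -/(coef3 s t n).
have E1 m : m + s + t = m + t + s by ring.
by rewrite /relation !E1.
Qed.

(* Both coefficient vectors satisfy the relation at [n + s] and [n + s + s]
   and have the same last entry, so their difference is annihilated by a
   nonzero 2x2 determinant. *)
Lemma coef12_periodic n :
  coef1 s t (n + s) = coef1 s t n /\ coef2 s t (n + s) = coef2 s t n.
Proof.
have [_ r1 r2] := coef_relations n.
have [r3 r4 _] := coef_relations (n + s).
move: r1 r2 r3 r4; rewrite /relation coef3_periodic => r1 r2 r3 r4.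
have nz := wronskian_neq0 (n + s + t).
suff [/subr0_eq -> /subr0_eq ->] :
  coef1 s t (n + s) - coef1 s t n = 0 /\ coef2 s t (n + s) - coef2 s t n = 0 by [].
apply: (@kernel2_eq0 _ _ _ (x (n + s + t + t)) (x (n + s + t))
   (x (n + s + s + t + t)) (x (n + s + s + t))).
- rewrite -oppr_eq0 opprB [x (_ + t + t) * _]mulrC.
  by move: nz; congr (is_true (x _ * x _ - x _ * x _ != 0)); ring.
- by apply/eqP; rewrite -subr_eq0; apply/eqP; rewrite -[RHS](subrr 0) -{1}r1 -r3; ring.
- by apply/eqP; rewrite -subr_eq0; apply/eqP; rewrite -[RHS](subrr 0) -{1}r2 -r4; ring.
Qed.

Lemma coef_relation n : relation n n.
Proof. by case: (coef_relations n). Qed.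

End Periodicity.

(** * Equivariance under the shift automorphism *)

Section Shift.
Variable Phi : {rmorphism F -> F}.
Hypothesis PhiE : forall n, Phi (x n) = x (n + 1).

Lemma minor_shift s n0 n1 n2 :
  Phi (minor s n0 n1 n2) = minor s (n0 + 1) (n1 + 1) (n2 + 1).
Proof.
rewrite /minor /triple !(rmorphB, rmorphD, rmorphM) /= !PhiE.
have E m : m + 1 + s = m + s + 1 by ring.
by rewrite !E.
Qed.

Lemma gram_shift s t n : Phi (gram s t n) = gram s t (n + 1).
Proof.
have E m : m + 1 + t = m + t + 1 by ring.
by rewrite /gram minor_shift !E.
Qed.

Lemma coef_shift s t n :
  [/\ Phi (coef1 s t n) = coef1 s t (n + 1),
      Phi (coef2 s t n) = coef2 s t (n + 1) &
      Phi (coef3 s t n) = coef3 s t (n + 1)].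
Proof.
have E m : m + 1 + t = m + t + 1 by ring.
by rewrite /coef1 /coef2 /coef3 !fmorph_div !gram_shift !minor_shift !E.
Qed.

End Shift.

End ShiftedMinors.

(** * Periodicity of the determinants and the two linear relations *)

Section Recurrence.
Variables (F : fieldType) (x : int -> F) (a : F) (k : int).
Local Notation k2 := (k + k).
Hypothesis x_rec : forall n, x (n + k2 + 1) * x n =
  x (n + k2) * x (n + 1) + a * (x (n + k) + x (n + k + 1)).
Hypothesis x_neq0 : forall n, x n != 0.

Local Notation delta := (gram x k2 1).
Let y n := x n + x (n + 1).

Lemma wronskianE n :
  x n * x (n + k2 + 1) - x (n + k2) * x (n + 1) = a * y (n + k).
Proof. by rewrite mulrC x_rec /y addrAC subrr add0r. Qed.

Lemma gram_formula n : delta n * x (n + k2 + 1) * x (n + k + 1) =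
  a ^+ 3 * (y (n + k) * y (n + k2 + 1) + y (n + k + 1) * y (n + k2)).
Proof.
have E m : m + 1 + k2 = m + k2 + 1 by ring.
have E' m : m + 1 + k = m + k + 1 by ring.
rewrite /gram /minor -(E n) triple_condensation !E.
have w0 := wronskianE n; have w1 := wronskianE (n + 1).
have w2 := wronskianE (n + k2); have w3 := wronskianE (n + k2 + 1).
have v0 := wronskianE (n + k); have v1 := wronskianE (n + k + 1).
rewrite !E in w1 w3 v1.
rewrite w0 w3 w1 w2.
have P m : m + k2 = m + k + k by ring.
rewrite !(P, E') in v0 v1 *.
(* Once [v0] and [v1] replace the inner factors [a * y], the terms free of [x (n + k + 1)] cancel,
   and that factor splits off. *)
transitivity (a ^+ 2 * (y (n + k) * (a * y (n + k + k + 1))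
    + y (n + k + 1) * (a * y (n + k + k)))); last by ring.
by rewrite -v0 -v1 /y; ring.
Qed.

Lemma gram_periodic n : delta (n + k) = delta n.
Proof.
have E m : m + 1 + k2 = m + k2 + 1 by ring.
have E' m : m + 1 + k = m + k + 1 by ring.
have P m : m + k2 = m + k + k by ring.
have d0 := gram_formula n; have d1 := gram_formula (n + k).
have v0 := wronskianE (n + k); have v1 := wronskianE (n + k + 1).
rewrite E E' in v1.
have n1 := x_neq0 (n + k + k2 + 1); have n2 := x_neq0 (n + k + k + 1).
have n3 := x_neq0 (n + k + 1).
apply: (mulIf (mulf_neq0 (mulf_neq0 n1 n2) n3)).
rewrite mulrA [delta (n + k) * _]mulrA d1.
rewrite P in d0.
have -> : delta n * (x (n + k + k2 + 1) * x (n + k + k + 1) * x (n + k + 1)) =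
  delta n * x (n + k + k + 1) * x (n + k + 1) * x (n + k + k2 + 1) by ring.
rewrite d0.
apply/eqP; rewrite -subr_eq0; apply/eqP.
(* Collected by [y (n + k + k)] and [y (n + k + k + 1)], the cofactors are Wronskians; by [v1] and
   [v0] each equals [a] times the other [y], so the two products cancel. *)
transitivity (a ^+ 2 * (a * y (n + k + k) *
     (x (n + k + 1) * x (n + k + k2 + 1 + 1) - x (n + k + k2 + 1) * x (n + k + 1 + 1))
   - a * y (n + k + k + 1) *
     (x (n + k) * x (n + k + k2 + 1) - x (n + k + k2) * x (n + k + 1)))).
  by rewrite /y; ring.
by rewrite v0 v1; ring.
Qed.

Lemma gram_periodic2 n : delta (n + k2) = delta n.
Proof. by rewrite addrA !gram_periodic. Qed.

Hypothesis a_neq0 : a != 0.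
Hypothesis y_neq0 : forall n, y n != 0.
Hypothesis gram_neq0 : forall n, delta n != 0.

Lemma wronskian_neq0 n :
  x n * x (n + k2 + 1) - x (n + k2) * x (n + 1) != 0.
Proof. by rewrite wronskianE mulf_neq0. Qed.

Lemma wronskianC_neq0 n :
  x n * x (n + 1 + k2) - x (n + 1) * x (n + k2) != 0.
Proof.
rewrite [x (n + 1) * _]mulrC.
have -> : n + 1 + k2 = n + k2 + 1 by ring.
exact: wronskian_neq0.
Qed.

Variable Phi : {rmorphism F -> F}.
Hypothesis PhiE : forall n, Phi (x n) = x (n + 1).

Lemma periodic_coefficients : exists alpha beta gamma : int -> F,
  [/\ forall n, [/\ Phi (alpha n) = alpha (n + 1), Phi (beta n) = beta (n + 1) &
                    Phi (gamma n) = gamma (n + 1)],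
      forall n, [/\ alpha (n + k) = alpha n, beta (n + k2) = beta n &
                    gamma (n + k2) = gamma n] &
      forall n, x (n + 1 + 1 + 1) - gamma n * x (n + 1 + 1)
                + beta n * x (n + 1) - alpha n * x n = 0].
Proof.
(* [coef3] is a ratio of consecutive [delta]s and inherits their period [k]; the other two
   coefficients only get the column step [k2]. *)
have c3p n : coef3 x k2 1 (n + k) = coef3 x k2 1 n.
  by rewrite /coef3 [n + k + 1]addrAC !gram_periodic.
have c3p2 n : coef3 x k2 1 (n + k2) = coef3 x k2 1 n by rewrite addrA !c3p.
have per := coef12_periodic gram_neq0 wronskian_neq0 c3p2.
exists (coef3 x k2 1), (coef2 x k2 1), (coef1 x k2 1); split=> n.
- by have [] := coef_shift PhiE k2 1 n.
- by rewrite c3p; have [-> ->] := per n.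
exact: (coef_relation gram_neq0).
Qed.

Variable Sigma : {rmorphism F -> F}.
Hypothesis SigmaE : forall n, Sigma (x n) = x (k2 - n).

(* Reversal turns the relation into one of the same shape with the roles of
   [Sigma K1] and [Sigma K2] exchanged; the coefficients being unique, this
   gives [K2 = Sigma K1]. *)
Lemma conserved_coefficients : exists K1 K2 : F,
  [/\ Phi K1 = K1, Phi K2 = K2, K2 = Sigma K1 &
      forall n, x (n + k2 + k2 + k2) - K1 * x (n + k2 + k2)
                + K2 * x (n + k2) - x n = 0].
Proof.
have nz n : gram x 1 k2 n != 0 by rewrite gramC gram_neq0.
(* Here [coef3] is [delta (n + k2) / delta n]. Being constant, it gives the other coefficients
   period 1, so they are invariant under [Phi]. *)
have c3 n : coef3 x 1 k2 n = 1.
  by rewrite /coef3 !(gramC x 1) gram_periodic2 divff.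
have c3p n : coef3 x 1 k2 (n + 1) = coef3 x 1 k2 n by rewrite !c3.
have per := coef12_periodic nz wronskianC_neq0 c3p.
have sh := coef_shift PhiE 1 k2.
have cst n : coef1 x 1 k2 n = coef1 x 1 k2 0 /\ coef2 x 1 k2 n = coef2 x 1 k2 0.
  by elim/int_shift_ind: n => [//|n]; have [-> ->] := per n.
set K1 := coef1 x 1 k2 0 in cst *; set K2 := coef2 x 1 k2 0 in cst *.
have rel n : x (n + k2 + k2 + k2) - K1 * x (n + k2 + k2) + K2 * x (n + k2) - x n = 0.
  by have := coef_relation nz n; rewrite c3 mul1r; have [-> ->] := cst n.
exists K1, K2; split=> //.
- by have [-> _ _] := sh 0; have [-> _] := per 0.
- by have [_ -> _] := sh 0; have [_ ->] := per 0.
have rel' n : x (n + k2 + k2 + k2) - Sigma K2 * x (n + k2 + k2)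
              + Sigma K1 * x (n + k2) - x n = 0.
  have SigmaL c d u v w z : Sigma (u - c * v + d * w - z) =
      Sigma u - Sigma c * Sigma v + Sigma d * Sigma w - Sigma z.
    by rewrite !(rmorphB, rmorphD, rmorphM).
  (* This base point makes the reversal send the four indices to [n], [n + k2], [n + 2 k2],
     [n + 3 k2]. *)
  have := congr1 Sigma (rel (- n - k2 - k2)).
  rewrite SigmaL [Sigma 0]rmorph0 !SigmaE => e.
  rewrite -oppr0 -[in RHS]e.
  have -> : k2 - (- n - k2 - k2 + k2 + k2 + k2) = n by ring.
  have -> : k2 - (- n - k2 - k2 + k2 + k2) = n + k2 by ring.
  have -> : k2 - (- n - k2 - k2 + k2) = n + k2 + k2 by ring.
  have -> : k2 - (- n - k2 - k2) = n + k2 + k2 + k2 by ring.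
  by ring.
have dif n : (K1 - Sigma K2) * x (n + k2 + k2) = (K2 - Sigma K1) * x (n + k2).
  apply/eqP; rewrite -subr_eq0; apply/eqP.
  by rewrite -[RHS](subrr 0) -{1}(rel' n) -(rel n); ring.
suff [_ /subr0_eq] : K1 - Sigma K2 = 0 /\ K2 - Sigma K1 = 0 by [].
apply: (kernel2_eq0 _ (dif 0) (dif 1)).
rewrite -oppr_eq0 opprB [X in _ - X]mulrC.
have := wronskianC_neq0 k2.
by congr (is_true (x _ * x _ - x _ * x _ != 0)); ring.
Qed.

End Recurrence.

(** The recurrence can be solved for either end by dividing by a nonzero value of [x], so agreement
    on a window of [2k + 1] terms spreads both ways. *)
Lemma recurrence_unique (F : fieldType) (x z : int -> F) (a : F) (k : nat) :
    let solves (u : int -> F) := forall n : int, u (n + (2 * k).+1%:Z) * u n =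
      u (n + (2 * k)%:Z) * u (n + 1) + a * (u (n + k%:Z) + u (n + k.+1%:Z)) in
    (0 < k)%N -> solves x -> solves z ->
    (forall n, x n != 0) ->
    (forall j : nat, (j <= 2 * k)%N -> x j = z j) ->
  forall n, x n = z n.
Proof.
move=> solves k_gt0 xP zP x0 xz.
pose window (n : int) := forall j : nat, (j <= 2 * k)%N -> x (n + j) = z (n + j).
suff w n : window n by move=> n; have := w n 0 (leq0n _); rewrite addr0.
elim/int_shift_ind: n => [|n]; first by move=> j /xz; rewrite add0r.
have xn := xP n; have zn := zP n.
have E (j : nat) : n + 1 + j = n + j.+1 by lia.
split=> w j jk; last first.
  case: j jk => [_|j jk]; last by rewrite -E w //; lia.
  have wS (i : nat) : (0 < i <= (2 * k).+1)%N -> x (n + i) = z (n + i).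
    by case: i => // i /andP[_ ?]; rewrite -E w.
  rewrite addr0; apply: (mulfI (x0 (n + (2 * k).+1%:Z))).
  by rewrite xn (wS 1) // !wS ?zn //; lia.
rewrite E; have [jlt|] := ltnP j (2 * k); first exact: w.
move=> jge; have -> : j = (2 * k)%N by lia.
apply: (mulIf (x0 n)); rewrite xn.
have -> : x n = z n by have := w 0 (leq0n _); rewrite addr0.
by rewrite zn (w 1) ?w //; lia.
Qed.

(** * Nonvanishing and reversal symmetry of the rational solution *)

Section RationalSolution.
Variables (R : realType) (k : nat).
Hypothesis k_gt0 : (0 < k)%N.
Local Notation F := (ratField R k).
Local Notation P := {mpoly R[i]%C[(2 * k).+2]}.
Local Notation toF := (@FracField.tofrac P : P -> F).
Local Notation x := (xseq R k).
Local Notation a := (par R k).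

Definition pos_at1 (p : P) := 0 < p.@[fun=> 1].

(** A certificate of nonvanishing that is stable under sums, products and inverses, hence under
    every subtraction-free formula. *)
Definition pos_frac (G : F) := exists p q : P,
  [/\ pos_at1 p, pos_at1 q & G = toF p / toF q].

Lemma pos_at1_neq0 p : pos_at1 p -> toF p != 0.
Proof.
rewrite tofrac_eq0 /pos_at1; apply: contraTneq => ->.
by rewrite meval0 ltxx.
Qed.

Lemma pos_frac_neq0 G : pos_frac G -> G != 0.
Proof.
by move=> [p [q [p0 q0 ->]]]; rewrite mulf_neq0 ?invr_eq0 ?pos_at1_neq0.
Qed.

Lemma pos_fracD G H : pos_frac G -> pos_frac H -> pos_frac (G + H).
Proof.
move=> [p [q [p0 q0 ->]]] [p' [q' [p'0 q'0 ->]]].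
exists (p * q' + p' * q), (q * q'); split.
- by rewrite /pos_at1 mevalD !mevalM addr_gt0 ?mulr_gt0.
- by rewrite /pos_at1 mevalM mulr_gt0.
- by rewrite addf_div ?pos_at1_neq0 // tofracD !tofracM.
Qed.

Lemma pos_fracM G H : pos_frac G -> pos_frac H -> pos_frac (G * H).
Proof.
move=> [p [q [p0 q0 ->]]] [p' [q' [p'0 q'0 ->]]].
exists (p * p'), (q * q'); split.
- by rewrite /pos_at1 mevalM mulr_gt0.
- by rewrite /pos_at1 mevalM mulr_gt0.
- by rewrite mulf_div !tofracM.
Qed.

Lemma pos_fracV G : pos_frac G -> pos_frac G^-1.
Proof. by move=> [p [q [p0 q0 ->]]]; exists q, p; rewrite invf_div. Qed.

Lemma pos_frac_indet j : pos_frac (indet R k j).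
Proof.
exists ('X_(inord j)), 1; split; last by rewrite tofrac1 divr1.
  by rewrite /pos_at1 mevalXU ltr01.
by rewrite /pos_at1 meval1 ltr01.
Qed.

Lemma pos_frac_xseq (n : nat) : pos_frac (x n).
Proof.
elim/ltn_ind: n => n IH.
have [nk|nk] := leqP n (2 * k); first by rewrite xseq_indet //; exact: pos_frac_indet.
have [m nE] : exists m, n = (m + (2 * k).+1)%N by exists (n - (2 * k).+1)%N; lia.
have := xseq_rec R k_gt0 m; rewrite -!PoszD -nE => e.
have -> : x n = (x (m + 2 * k)%N * x (m + 1)%N + a * (x (m + k)%N + x (m + k.+1)%N)) / x m.
  by rewrite -e mulfK // xseq_neq0.
apply: pos_fracM; last by apply/pos_fracV/IH; lia.
apply: pos_fracD; first by apply: pos_fracM; apply: IH; lia.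
by apply: pos_fracM; [exact: pos_frac_indet | apply: pos_fracD; apply: IH; lia].
Qed.

Let Phi : {rmorphism F -> F} := HB.pack (@phi_star R k)
  (GRing.isZmodMorphism.Build F F _ (phi_star_rmorphism R k_gt0).1)
  (GRing.isMonoidMorphism.Build F F _ (phi_star_rmorphism R k_gt0).2).

Let Sigma : {rmorphism F -> F} := HB.pack (@sigma_star R k)
  (GRing.isZmodMorphism.Build F F _ (sigma_star_rmorphism R k_gt0).1)
  (GRing.isMonoidMorphism.Build F F _ (sigma_star_rmorphism R k_gt0).2).

Lemma PhiE n : Phi (x n) = x (n + 1).
Proof. exact: phi_star_xseq. Qed.

Lemma sigma_star_indet j : (j <= 2 * k)%N ->
  sigma_star (indet R k j) = indet R k (2 * k - j).
Proof.
move=> jk; rewrite /sigma_star (eval_at_toF (sigma_inj k_gt0)) poly_at_indet; last lia.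
by rewrite sigma_coords ?jk //; lia.
Qed.

Lemma sigma_star_par : sigma_star a = a.
Proof.
by rewrite /sigma_star (eval_at_toF (sigma_inj k_gt0)) poly_at_indet // sigma_coords // ltnn.
Qed.

Lemma sigma_star_xseq n : sigma_star (x n) = x ((2 * k)%:Z - n).
Proof.
suff E m : x m = Sigma (x ((2 * k)%:Z - m)).
  by rewrite [RHS]E /=; congr (sigma_star (x _)); lia.
apply: (recurrence_unique (z := fun m => Sigma (x ((2 * k)%:Z - m))) k_gt0
  (xseq_rec R k_gt0)) => [{}m|{}m|j jk].
(* Reflection maps the indices [m], ..., [m + 2k + 1] onto [m'], ..., [m' + 2k + 1] in reverse
   order, and the recurrence is symmetric under this reversal. *)
- pose m' : int := - m - 1.
  have -> : (2 * k)%:Z - (m + (2 * k).+1%:Z) = m' by rewrite /m'; lia.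
  have -> : (2 * k)%:Z - m = m' + (2 * k).+1%:Z by rewrite /m'; lia.
  have -> : (2 * k)%:Z - (m + (2 * k)%:Z) = m' + 1 by rewrite /m'; lia.
  have -> : (2 * k)%:Z - (m + 1) = m' + (2 * k)%:Z by rewrite /m'; lia.
  have -> : (2 * k)%:Z - (m + k%:Z) = m' + k.+1%:Z by rewrite /m'; lia.
  have -> : (2 * k)%:Z - (m + k.+1%:Z) = m' + k%:Z by rewrite /m'; lia.
  have Ea : a = Sigma a by rewrite /= sigma_star_par.
  rewrite -rmorphM mulrC xseq_rec // [LHS]rmorphD ![Sigma (_ * _)]rmorphM -Ea
    [Sigma (_ + _)]rmorphD.
  by congr (_ + _); [exact: mulrC | congr (_ * _); exact: addrC].
- exact: xseq_neq0.
- rewrite subzn // !xseq_indet; try lia.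
  by rewrite /= sigma_star_indet ?leq_subr // subKn.
Qed.

Lemma shift_powE (f : int -> F) :
  (forall n, Phi (f n) = f (n + 1)) -> forall n, f n = phi_star_pow n (f 0).
Proof.
move=> fS; elim/int_shift_ind => [//|n].
rewrite phi_star_powS // -fS; split=> [-> //|].
exact: (fmorph_inj Phi).
Qed.

(** A field morphism is injective, so nonvanishing travels in both directions; positivity is then
    needed only at nonnegative indices. *)
Lemma shift_neq0 (f : int -> F) :
  (forall n, Phi (f n) = f (n + 1)) -> f 0 != 0 -> forall n, f n != 0.
Proof.
by move=> fS f0; elim/int_shift_ind => [//|n]; rewrite -fS fmorph_eq0.
Qed.

Lemma xseq_rec_int n : x (n + (k%:Z + k%:Z) + 1) * x n =
  x (n + (k%:Z + k%:Z)) * x (n + 1) + a * (x (n + k%:Z) + x (n + k%:Z + 1)).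
Proof.
have := xseq_rec R k_gt0 n.
by congr (x _ * x _ = x _ * x _ + a * (x _ + x _)); lia.
Qed.

Lemma xseqD_neq0 n : x n + x (n + 1) != 0.
Proof.
apply: (@shift_neq0 (fun n => x n + x (n + 1))) => [m|].
  by rewrite rmorphD /= !phi_star_xseq.
by rewrite add0r; apply/pos_frac_neq0/pos_fracD; exact: pos_frac_xseq.
Qed.

Lemma gram_xseq_neq0 n : gram x (k%:Z + k%:Z) 1 n != 0.
Proof.
apply: (shift_neq0 (gram_shift PhiE _ _)).
(* The determinant itself has signs, but the right-hand side of [gram_formula] is
   subtraction-free. *)
have := gram_formula xseq_rec_int 0; rewrite !add0r => e.
set rhs := (X in _ = X) in e.
have : rhs != 0.
  apply: mulf_neq0; first by apply: expf_neq0; exact: indet_neq0.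
  by apply: pos_frac_neq0; rewrite -!PoszD; apply: pos_fracD; apply: pos_fracM; apply: pos_fracD;
    exact: pos_frac_xseq.
by rewrite -e; apply: contraNneq => ->; rewrite !mul0r.
Qed.

Lemma xseq_conserved_relation : exists K1 K2 : F,
  [/\ phi_star K1 = K1, phi_star K2 = K2, K2 = sigma_star K1 &
      forall n, x (n + (6 * k)%:Z) - K1 * x (n + (4 * k)%:Z)
                + K2 * x (n + (2 * k)%:Z) - x n = 0].
Proof.
have sE n : Sigma (x n) = x (k%:Z + k%:Z - n).
  by rewrite [LHS]sigma_star_xseq mul2n -addnn.
have [K1 [K2 [e1 e2 e3 rel]]] := conserved_coefficients xseq_rec_int
  (xseq_neq0 R k_gt0) (indet_neq0 _ _ _) xseqD_neq0 gram_xseq_neq0 PhiE sE.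
exists K1, K2; split=> // n.
by have := rel n; congr (x _ - K1 * x _ + K2 * x _ - x n = 0); lia.
Qed.

Lemma xseq_periodic_relation : exists alpha beta gamma : int -> F,
  [/\ forall n, [/\ alpha n = phi_star_pow n (alpha 0),
                    beta n = phi_star_pow n (beta 0) &
                    gamma n = phi_star_pow n (gamma 0)],
      forall n, [/\ alpha (n + k%:Z) = alpha n,
                    beta (n + (2 * k)%:Z) = beta n &
                    gamma (n + (2 * k)%:Z) = gamma n] &
      forall n, x (n + 3) - gamma n * x (n + 2)
                + beta n * x (n + 1) - alpha n * x n = 0].
Proof.
have [al [be [ga [sh per rel]]]] := periodic_coefficients xseq_rec_int
  (xseq_neq0 R k_gt0) (indet_neq0 _ _ _) xseqD_neq0 gram_xseq_neq0 PhiE.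
exists al, be, ga; split=> n.
- by split; apply: shift_powE => m; have [] := sh m.
- by rewrite mul2n -addnn.
- by have := rel n; rewrite -!addrA.
Qed.

End RationalSolution.

Theorem theorem2p5 (R : realType) (k : nat) (hk : (1 <= k)%N) :
  (exists K1 K2 : ratField R k,
     [/\ phi_star K1 = K1,
         phi_star K2 = K2,
         K2 = sigma_star K1 &
         forall n : int,
           xseq R k (n + (6 * k)%:Z) - K1 * xseq R k (n + (4 * k)%:Z)
             + K2 * xseq R k (n + (2 * k)%:Z) - xseq R k n = 0])
  /\
  (exists alpha beta gamma : int -> ratField R k,
     [/\ forall n : int, [/\ alpha n = phi_star_pow n (alpha 0),
                             beta n = phi_star_pow n (beta 0) &
                             gamma n = phi_star_pow n (gamma 0)],
         forall n : int, [/\ alpha (n + k%:Z) = alpha n,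
                             beta (n + (2 * k)%:Z) = beta n &
                             gamma (n + (2 * k)%:Z) = gamma n] &
         forall n : int,
           xseq R k (n + 3) - gamma n * xseq R k (n + 2)
             + beta n * xseq R k (n + 1) - alpha n * xseq R k n = 0]).
Proof.
by split; [exact: xseq_conserved_relation | exact: xseq_periodic_relation].
Qed.
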